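(* Let $F$ and $K$ be two finite fields such that $|F|\ge 3$ and $|K|\geq 3$. Then $\Gamma(F \times K)$ is partitionable into global defensive alliances, and $\psi_g(\Gamma(F\times K))=3$ if $|F|=|K|=4$, while $\psi_g(\Gamma(F\times K))=2$ otherwise.
   Context: For a commutative ring $R$ with $1\neq 0$, the zero-divisor graph $\Gamma(R)$ is the simple graph whose vertices are the nonzero zero-divisors of $R$, two distinct vertices $x,y$ being adjacent if and only if $xy=0$. Let $\Gamma=(V,E)$ be a finite simple graph. For $S\subseteq V$ put $\bar S=V\setminus S$ and $\deg_S(x)=|S\cap N(x)|$, where $N(x)$ is the set of vertices adjacent to $x$. A nonempty $S\subseteq V$ is a dominating set if $\deg_S(v)>0$ for every $v\in\bar S$; it is a defensive alliance if $\deg_S(x)+1\ge \deg_{\bar S}(x)$ for every $x\in S$; it is a global defensive alliance if it is both. The global defensive alliance partition number $\psi_g(\Gamma)$ is the maximum number of sets in a partition of $V$ such that each set is a global defensive alliance; $\Gamma$ is partitionable into global defensive alliances if $\psi_g(\Gamma)\ge 2$. *)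

(* Defs.v *)
From HB Require Import structures.
From mathcomp Require Import all_boot all_order all_algebra.

Set Implicit Arguments.
Unset Strict Implicit.
Unset Printing Implicit Defensive.

Import GRing.Theory.

(* The library equips products with the finType and the comNzRingType structure
   separately; this joins the two. *)
HB.instance Definition _ (R1 R2 : finComNzRingType) :=
  GRing.NzRing.on (R1 * R2)%type.

Record sgraph := SGraph {
  vertex :> finType;
  adj : rel vertex;
  adj_sym : symmetric adj;
  adj_irrefl : irreflexive adj
}.

Section Alliances.
Variable G : sgraph.
Implicit Types (S : {set G}) (x : G) (P : {set {set G}}).

Definition nbhd x : {set G} := [set y | adj x y].

Definition deg_in S x : nat := #|S :&: nbhd x|.

Definition dominating S : bool :=
  (S != set0) && [forall x in ~: S, 0 < deg_in S x].

Definition defensive_alliance S : bool :=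
  (S != set0) && [forall x in S, deg_in (~: S) x <= deg_in S x + 1].

Definition global_defensive_alliance S : bool :=
  defensive_alliance S && dominating S.

Definition gda_partition P : bool :=
  partition P [set: G] && [forall S in P, global_defensive_alliance S].

(* [set: G] is itself a global defensive alliance when G has a vertex, so the
   maximum ranges over a nonempty family (for the empty graph, P = set0). *)
Definition psi_g : nat := \max_(P : {set {set G}} | gda_partition P) #|P|.

Definition partitionable : Prop := 2 <= psi_g.

End Alliances.

Section ZeroDivisorGraph.
Variable R : finComNzRingType.
Local Open Scope ring_scope.

Definition zero_divisor (x : R) : bool := [exists y : R, (y != 0) && (x * y == 0)].

Definition zdg_vertex : finType := {x : R | (x != 0) && zero_divisor x}.

Definition zdg_adj : rel zdg_vertex :=
  fun x y => (x != y) && (val x * val y == 0).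

Lemma zdg_adj_sym : symmetric zdg_adj.
Proof. by move=> x y; rewrite /zdg_adj eq_sym mulrC. Qed.

Lemma zdg_adj_irrefl : irreflexive zdg_adj.
Proof. by move=> x; rewrite /zdg_adj eqxx. Qed.

Definition zero_divisor_graph : sgraph := SGraph zdg_adj_sym zdg_adj_irrefl.

End ZeroDivisorGraph.

(* Main.v *)
Require Import Defs.
From mathcomp Require Import all_boot all_order all_algebra.
From mathcomp Require Import zify.

(** [Γ(F × K)] is complete bipartite, with sides [F^* × 0] and [0 × K^*] of sizes
    at least 2.  In such a graph [S] is a global defensive alliance iff on each
    side, of size [n], it has at least [max(1, (n - 1) / 2)] vertices.  Hence a
    partition into [k] of them satisfies [k <= n] and [k (n - 1) <= 2 n] for
    both sizes [n], which forces [k <= 2] unless both sizes are 3, and then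
    [k <= 3].  Conversely, distributing each side evenly among [k] classes works
    for [k = 2], and for [k = 3] when both sizes are 3. *)

Set Implicit Arguments.
Unset Strict Implicit.
Unset Printing Implicit Defensive.

(** Colour each element by its index in [enum A] modulo [k]: every colour recurs once in each full
    block of [k] consecutive indices. *)
Lemma balanced_coloring (T : finType) (A : {set T}) (k : nat) (k_gt0 : 0 < k) :
  exists c : T -> 'I_k, forall i, #|A| %/ k <= #|[set x in A | c x == i]|.
Proof.
pose s := enum A.
exists (fun x => Ordinal (ltn_pmod (index x s) k_gt0)) => i.
(* A zero quotient leaves nothing to prove; otherwise [A] has an element [x0], needed as the default
   of [nth]. *)
case: (posnP (#|A| %/ k)) => [-> // | A_gt0].
have [x0 _] : exists x0, x0 \in A.
  by apply/card_gt0P; apply: leq_trans A_gt0 (leq_div _ _).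
have lt_s j : j < #|A| %/ k -> j * k + i < size s.
  move=> lt_j; rewrite -cardE; apply: leq_trans (leq_divM _ k).
  apply: (@leq_trans (j.+1 * k)); last by rewrite leq_mul2r lt_j orbT.
  by rewrite mulSn addnC ltn_add2r.
(* [t] picks the elements of colour [i] at indices [j * k + i], one from each full block. *)
pose t := [seq nth x0 s (j * k + i) | j <- iota 0 (#|A| %/ k)].
have uniq_t : uniq t.
  rewrite map_inj_in_uniq ?iota_uniq // => j j'.
  rewrite !mem_iota /= !add0n => /lt_s ltj /lt_s ltj' /eqP.
  rewrite nth_uniq ?enum_uniq // eqn_add2r eqn_pmul2r //.
  by move/eqP.
have <-: size t = #|A| %/ k by rewrite size_map size_iota.
rewrite cardE; apply: uniq_leq_size => // x /mapP[j].
rewrite mem_iota add0n => /lt_s ltj ->.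
rewrite mem_enum inE -mem_enum mem_nth //=; apply/eqP/val_inj => /=.
by rewrite index_uniq ?enum_uniq // modnMDl modn_small.
Qed.

Lemma sum_card_setI (T : finType) (P : {set {set T}}) (B : {set T}) :
  partition P [set: T] -> \sum_(S in P) #|S :&: B| = #|B|.
Proof.
move=> partP; transitivity (\sum_(x in [set: T] | x \in B) 1).
  rewrite (set_partition_big_cond P partP); apply: eq_bigr => S _.
  by rewrite -sum1_card; apply: eq_bigl => x; rewrite inE.
by rewrite -sum1_card; apply: eq_bigl => x; rewrite inE.
Qed.

Section CompleteBipartite.
Variables (G : sgraph) (side : G -> bool).
Hypothesis adjE : forall x y, adj x y = side x (+) side y.

Definition part (b : bool) : {set G} := [set x | side x == b].
Hypothesis part_gt1 : forall b, 1 < #|part b|.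

Lemma nbhd_part x : nbhd x = part (~~ side x).
Proof. by apply/setP=> y; rewrite !inE adjE; case: (side x) (side y) => [] []. Qed.

Lemma gdaP (S : {set G}) :
  reflect (forall b, 0 < #|S :&: part b| /\ #|part b| <= (#|S :&: part b|).*2.+1)
          (global_defensive_alliance S).
Proof.
have cardC b : #|~: S :&: part b| = #|part b| - #|S :&: part b|.
  by rewrite -(cardsID S (part b)) setDE setIC [part b :&: S]setIC addKn.
have le_part b : #|S :&: part b| <= #|part b| by rewrite subset_leq_card ?subsetIr.
apply: (iffP idP) => [/andP[/andP[S_n0 /forall_inP defS] /andP[_ /forall_inP domS]] | gS].
  (* All neighbours of a vertex lie on the opposite side, so a single member of [S] on side [b]
     turns defence into a bound on the other side. *)
  have def b : 0 < #|S :&: part b| -> #|part (~~ b)| <= (#|S :&: part (~~ b)|).*2.+1.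
    case/card_gt0P=> x; rewrite !inE => /andP[Sx /eqP sx].
    by have := defS x Sx; rewrite /deg_in nbhd_part sx cardC; have := le_part (~~ b); lia.
  have dom b : #|S :&: part b| = 0 -> 0 < #|S :&: part (~~ b)|.
    move=> Sb0; have /card_gt0P[x] := ltnW (part_gt1 b).
    move=> bx; move: (bx); rewrite inE => /eqP sx.
    have notSx : x \in ~: S.
      rewrite inE; apply/negP => Sx; move/eqP: Sb0; rewrite cards_eq0 => /eqP/setP/(_ x).
      by rewrite in_setI Sx bx inE.
    by have := domS x notSx; rewrite /deg_in nbhd_part sx.
  (* If [S] missed side [b], domination would give it a member on the other side, whose defence
     would allow at most one vertex on side [b]. *)
  have pos b : 0 < #|S :&: part b|.
    rewrite lt0n; apply/negP => /eqP Sb0.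
    have := def _ (dom _ Sb0); rewrite negbK Sb0; have := part_gt1 b; lia.
  by move=> b; split=> //; rewrite -[b]negbK; apply: def.
have S_n0 : S != set0.
  have [/card_gt0P[x] ] := gS true; rewrite inE => /andP[Sx _] _.
  by apply/set0Pn; exists x.
rewrite /global_defensive_alliance /defensive_alliance /dominating S_n0 /=.
apply/andP; split; apply/forall_inP => x _; rewrite /deg_in nbhd_part.
  by rewrite cardC; have [_] := gS (~~ side x); lia.
by have [] := gS (~~ side x).
Qed.

Lemma gda_partition_bounds (P : {set {set G}}) b :
  gda_partition P -> #|P| <= #|part b| /\ #|P| * #|part b|.-1 <= (#|part b|).*2.
Proof.
case/andP=> partP /forall_inP gdaS; have sumP := sum_card_setI (part b) partP.
split.
  rewrite -sumP -sum1_card; apply: leq_sum => S /gdaS/gdaP/(_ b)[] //.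
(* With [n] the size of the side, both members become sums over the classes, to be compared
   termwise: each class [S] satisfies [n - 1 <= 2 * #|S :&: part b|]. *)
rewrite -{2}sumP -mul2n big_distrr /= -sum_nat_const.
by apply: leq_sum => S /gdaS/gdaP/(_ b)[_]; lia.
Qed.

Lemma psi_g_ge k :
  (forall b, 0 < #|part b| %/ k /\ #|part b| <= (#|part b| %/ k).*2.+1) ->
  k <= psi_g G.
Proof.
case: (posnP k) => [-> // | k_gt0] hk.
have [c1 hc1] := balanced_coloring (part true) k_gt0.
have [c0 hc0] := balanced_coloring (part false) k_gt0.
pose c x := if side x then c1 x else c0 x.
pose cls i := [set x | c x == i].
have cls_part i b : #|part b| %/ k <= #|cls i :&: part b|.
  case: b; [apply: leq_trans (hc1 i) _ | apply: leq_trans (hc0 i) _];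
    apply: subset_leq_card; apply/subsetP=> x;
    by rewrite !inE /c => /andP[/eqP-> ->].
have gda_cls i : global_defensive_alliance (cls i).
  by apply/gdaP=> b; have := cls_part i b; have := hk b; lia.
have cls_n0 i : cls i != set0 by case/andP: (gda_cls i) => /andP[].
have cls_inj : injective cls.
  (* A common member of two equal nonempty classes has both colours, so the [k] colours yield [k]
     distinct classes. *)
  move=> i j eq_ij; have /set0Pn[x] := cls_n0 i.
  by move=> xi; move: (xi); rewrite eq_ij; move: xi; rewrite !inE => /eqP-> /eqP.
rewrite -[k in k <= _]card_ord -(card_imset _ cls_inj).
apply: (@leq_bigmax_cond _ _ (fun P : {set {set G}} => #|P|)).
apply/andP; split; last by apply/forall_inP => _ /imsetP[i _ ->].
apply/and3P; split.
- rewrite eqEsubset subsetT; apply/subsetP=> x _; apply/bigcupP.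
  by exists (cls (c x)); rewrite ?imset_f ?inE.
- apply/trivIsetP=> _ _ /imsetP[i _ ->] /imsetP[j _ ->] neq_ij.
  apply/pred0P=> x; rewrite /= !inE; apply/negP=> /andP[/eqP xi /eqP xj].
  by rewrite -xi -xj eqxx in neq_ij.
- by apply/imsetP=> -[i _ /esym/eqP]; rewrite (negPf (cls_n0 i)).
Qed.

Lemma psi_g_ge2 : 2 <= psi_g G.
Proof. by apply: psi_g_ge => b; have := part_gt1 b; lia. Qed.

Lemma psi_g_eq3 : (forall b, #|part b| = 3) -> psi_g G = 3.
Proof.
move=> part3; apply/eqP; rewrite eqn_leq; apply/andP; split.
  apply/bigmax_leqP=> P /(gda_partition_bounds true)[+ _].
  by rewrite part3.
by apply: psi_g_ge => b; rewrite part3.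
Qed.

Lemma psi_g_eq2 b : #|part b| <> 3 -> psi_g G = 2.
Proof.
move=> partN3; apply/eqP; rewrite eqn_leq psi_g_ge2 andbT.
apply/bigmax_leqP=> P /(gda_partition_bounds b)[].
move=> le1 le2; rewrite leqNgt; apply/negP=> gt2.
(* Three or more classes force both [3 <= n] and [3 * (n - 1) <= 2 * n] for the side size [n], hence
   [n = 3]. *)
have : 3 * #|part b|.-1 <= (#|part b|).*2.
  by apply: leq_trans le2; rewrite leq_mul2r gt2 orbT.
by lia.
Qed.

End CompleteBipartite.

Section ProductOfFields.
Import GRing.Theory.
Local Open Scope ring_scope.
Variables F K : finFieldType.

Let G := zero_divisor_graph (F * K)%type.
(** The value [true] marks the side [0 × K^*], and [false] marks [F^* × 0]. *)
Definition zdg_side (x : G) : bool := (val x).1 == 0.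

Lemma zdg_vertexE (u : F) (v : K) :
  (((u, v) : F * K) != 0) && zero_divisor ((u, v) : F * K) = (u == 0) (+) (v == 0).
Proof.
rewrite /zero_divisor xpair_eqE.
case: (eqVneq u 0) (eqVneq v 0) => [->|u0] [->|v0] //=.
(* The idempotent supported on the zero coordinate annihilates the pair. *)
- apply/existsP; exists (1, 0); rewrite !xpair_eqE oner_eq0 /=.
  by rewrite mul0r mulr0 !eqxx.
- apply/existsP; exists (0, 1); rewrite !xpair_eqE oner_eq0 andbF /=.
  by rewrite mul0r mulr0 !eqxx.
- apply/existsP=> -[[y z]]; rewrite !xpair_eqE !mulf_eq0 (negPf u0) (negPf v0) /=.
  by rewrite andNb.
Qed.

Lemma zdg_sideN (x : G) : ((val x).2 == 0) = ~~ zdg_side x.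
Proof.
rewrite /zdg_side; case: x => -[u v] /= p.
by have := p; rewrite zdg_vertexE; do 2![case: eqP].
Qed.

(** The first coordinates multiply to 0 iff some vertex is on side [true], the second iff some
    vertex is on side [false]; both happen exactly when the sides differ, and then the vertices are
    distinct. *)
Lemma zdg_adjE (x y : G) : adj x y = zdg_side x (+) zdg_side y.
Proof.
have ->: adj x y =
  (x != y) && (((val x).1 * (val y).1 == 0) && ((val x).2 * (val y).2 == 0)).
  by [].
rewrite !mulf_eq0 !zdg_sideN -!/(zdg_side _).
case: (eqVneq x y) => [-> | _ /=]; first by rewrite addbb.
by case: (zdg_side x) (zdg_side y) => [] [].
Qed.

(** Projection to the nonzero coordinate is a bijection from each side onto the nonzero elements of
    the corresponding field. *)
Lemma card_zdg_part b : #|part zdg_side b| = (if b then #|K| else #|F|).-1.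
Proof.
case: b; rewrite -(cardsC1 0).
- rewrite -(card_in_imset (f := fun x : G => (val x).2)).
    congr #|pred_of_set _|; apply/setP=> v; rewrite !inE; apply/imsetP/idP.
      by case=> x; rewrite inE => /eqP sx ->; rewrite zdg_sideN sx.
    move=> v0; have p : ((0, v) != 0 :> F * K) && zero_divisor ((0, v) : F * K).
      by rewrite zdg_vertexE eqxx (negPf v0).
    by exists (Sub (0, v) p : G); rewrite // inE /zdg_side /= eqxx.
  move=> x y; rewrite !inE /zdg_side => /eqP/eqP x1 /eqP/eqP y1 eq2.
  by apply/val_inj/injective_projections; rewrite ?x1 ?y1.
- rewrite -(card_in_imset (f := fun x : G => (val x).1)).
    congr #|pred_of_set _|; apply/setP=> u; rewrite !inE; apply/imsetP/idP.
      by case=> x; rewrite inE /zdg_side => /eqP/negbT sx ->.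
    move=> u0; have p : ((u, 0) != 0 :> F * K) && zero_divisor ((u, 0) : F * K).
      by rewrite zdg_vertexE eqxx (negPf u0).
    by exists (Sub (u, 0) p : G); rewrite // inE /zdg_side /= (negPf u0).
  move=> x y; rewrite !inE => /eqP/negbT x2 /eqP/negbT y2 eq1.
  move: x2 y2; rewrite -!zdg_sideN => /eqP x2 /eqP y2.
  by apply/val_inj/injective_projections; rewrite ?x2 ?y2.
Qed.

End ProductOfFields.

Theorem theorem3p10 (F K : finFieldType) (hF : 3 <= #|F|) (hK : 3 <= #|K|) :
  partitionable (zero_divisor_graph (F * K)%type) /\
  (#|F| = 4 /\ #|K| = 4 -> psi_g (zero_divisor_graph (F * K)%type) = 3) /\
  (~ (#|F| = 4 /\ #|K| = 4) -> psi_g (zero_divisor_graph (F * K)%type) = 2).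
Proof.
have part_gt1 b : 1 < #|part (@zdg_side F K) b|.
  by rewrite card_zdg_part; case: b; lia.
have adjE := @zdg_adjE F K.
split; first exact: psi_g_ge2 adjE part_gt1.
split=> [[F4 K4] | N4].
  by apply: psi_g_eq3 adjE part_gt1 _ => b; rewrite card_zdg_part F4 K4; case: b.
(* Choose a side whose size is not 3: the one from [K] if [#|F| = 4], since then [#|K|] is not 4,
   and the one from [F] otherwise. *)
have [F4 | F_neq4] := eqVneq #|F| 4; [pose b := true | pose b := false];
  by apply: (psi_g_eq2 adjE part_gt1 (b := b)); rewrite card_zdg_part /b; lia.
Qed.
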